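(* Let $k\ge1$, let $t_1,\dots,t_k$ be integers such that $\mathcal{C}(X)=X^k-t_1X^{k-1}-\dots-t_k$ is irreducible over $\mathbb{Q}$, and let $p$ be a prime with $p\nmid t_k$. Then $p$ divides $c_p[t_1,\dots,t_k]$ if and only if $p$ divides the discriminant $\operatorname{disc}(\mathcal{C})$ of the polynomial $\mathcal{C}$.
   Context: $c_p[t_1,\dots,t_k]$ is the least period of the sequence $(F_{k,n}(t_1,\dots,t_k)\bmod p)_{n\ge0}$, where $F_{k,0}=1$, $F_{k,m}=0$ for $-k+1\le m\le-1$, and $F_{k,n}=\sum_{j=1}^kt_jF_{k,n-j}$ for $n\ge1$ (equivalently $F_{k,n}=\sum_{\alpha}\binom{|\alpha|}{\alpha_1,\dots,\alpha_k}t_1^{\alpha_1}\cdots t_k^{\alpha_k}$ over $\alpha\in\mathbb{Z}_{\ge0}^k$ with $\sum_jj\alpha_j=n$, $|\alpha|=\sum_j\alpha_j$). The discriminant of $\mathcal{C}$ is $\operatorname{disc}(\mathcal{C})=(-1)^{k(k-1)/2}\prod_{i}\mathcal{C}'(\lambda_i)$ over the roots $\lambda_i$ of $\mathcal{C}$. *)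

(* Defs.v *)
From mathcomp Require Import all_boot all_order all_algebra all_field.
From mathcomp Require Import boolp classical_sets.
Set Implicit Arguments.
Unset Strict Implicit.
Unset Printing Implicit Defensive.
Import Order.TTheory GRing.Theory Num.Theory.
Local Open Scope ring_scope.

(* A parameter vector (t_1, ..., t_k) is given by k : nat and t : nat -> int;
   only the values t 1, ..., t k are ever used. *)

Definition core_poly (k : nat) (t : nat -> int) : {poly int} :=
  'X^k - \sum_(1 <= j < k.+1) t j *: 'X^(k - j).

(* gfib_rev k t n = [:: F_n; F_(n-1); ...; F_0].  Reading past the end of the
   list yields 0, which accounts for the initial values F_m = 0 for m < 0. *)
Fixpoint gfib_rev (k : nat) (t : nat -> int) (n : nat) : seq int :=
  if n is m.+1 then
    (\sum_(1 <= j < k.+1) t j * (gfib_rev k t m)`_(j.-1)) :: gfib_rev k t m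
  else [:: 1].

Definition gfib (k : nat) (t : nat -> int) (m : int) : int :=
  if m is Posz n then (gfib_rev k t n)`_0 else 0.

Definition is_least_period (T : Type) (u : nat -> T) (c : nat) : Prop :=
  [/\ (0 < c)%N,
      (forall n, u (n + c)%N = u n)
    & forall d, (0 < d)%N -> (forall n, u (n + d)%N = u n) -> (c <= d)%N].

(* The junk value 0 is taken only by sequences that are not purely periodic. *)
Definition least_period (T : Type) (u : nat -> T) : nat :=
  xget 0%N [set c | is_least_period u c].

Definition gfib_period (p k : nat) (t : nat -> int) : nat :=
  least_period (fun n : nat => (gfib k t n %% p)%Z).

Definition complex_roots (f : {poly int}) : seq algC :=
  sval (closed_field_poly_normal (map_poly intr f : {poly algC})).

(* Intended for monic f only: the factor lead_coef f ^+ (2 * deg f - 2) of the general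
   discriminant is omitted. *)
Definition disc (f : {poly int}) : algC :=
  let d := (size f).-1 in
  (-1) ^+ ((d * d.-1)./2) *
  \prod_(z <- complex_roots f) (map_poly intr f^`()).[z].

Lemma gfib0 k t : gfib k t 0 = 1.
Proof. by []. Qed.

Lemma gfib_neg k t (m : int) : m < 0 -> gfib k t m = 0.
Proof. by case: m. Qed.

Lemma gfib_revE k t n j : (gfib_rev k t n)`_j = gfib k t (n%:Z - j%:Z).
Proof.
elim: n j => [|n IHn] [|j]; rewrite ?subr0 //=; first by rewrite nth_nil.
by rewrite IHn !intS opprD addrACA subrr add0r.
Qed.

Lemma gfib_rec k t (n : int) :
  1 <= n -> gfib k t n = \sum_(1 <= j < k.+1) t j * gfib k t (n - j%:Z).
Proof.
case: n => [[|n]|] //= _; apply: eq_big_nat => -[|j] //= _.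
by rewrite gfib_revE !intS opprD addrACA subrr add0r.
Qed.

Lemma size_core_poly_tail k (t : nat -> int) :
  (size (\sum_(1 <= j < k.+1) t j *: 'X^(k - j) : {poly int})%R <= k)%N.
Proof.
rewrite big_nat; apply: (leq_trans (size_sum _ _ _)).
apply/bigmax_leqP_seq => -[|j] // _ /andP[_ ltjk].
apply: leq_trans (size_scale_leq _ _) _; rewrite size_polyXn.
by rewrite -subSn // subSS leq_subr.
Qed.

Lemma size_core_poly k t : size (core_poly k t) = k.+1.
Proof.
by rewrite /core_poly size_polyDl size_polyXn // size_polyN ltnS size_core_poly_tail.
Qed.

Lemma core_poly_monic k t : core_poly k t \is monic.
Proof.
rewrite monicE /core_poly lead_coefDl ?lead_coefXn //.
by rewrite size_polyN size_polyXn ltnS size_core_poly_tail.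
Qed.

Lemma complex_rootsE (f : {poly int}) : f \is monic ->
  map_poly intr f = \prod_(z <- complex_roots f) ('X - z%:P) :> {poly algC}.
Proof.
move=> fm; rewrite /complex_roots; case: closed_field_poly_normal => r /= Dr.
by rewrite {1}Dr (monicP (monic_map _ fm)) scale1r.
Qed.

Section PeriodExists.

Variables (k p : nat) (t : nat -> int).
Hypotheses (k_gt0 : (0 < k)%N) (p_pr : prime p) (ptk : ~~ (p %| t k)%Z).

Let f (n : nat) : 'F_p := (gfib k t n)%:~R.

Let intr_Fp_eq (a b : int) :
  (a%:~R == b%:~R :> 'F_p) = ((a %% p)%Z == (b %% p)%Z).
Proof.
rewrite -subr_eq0 -intrB eqz_mod_dvd -(@dvdz_pcharf _ p) //.
exact: pchar_Fp.
Qed.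

Let f_rec n : f (n + k) = \sum_(1 <= j < k.+1) (t j)%:~R * f (n + k - j).
Proof.
rewrite /f gfib_rec; last by case: (n + k)%N (leq_addl n k) (leq_trans k_gt0 (leq_addl n k)).
rewrite rmorph_sum big_nat [RHS]big_nat; apply: eq_bigr => j /andP[_ ltjk].
by rewrite /= rmorphM /= subzn // (leq_trans _ (leq_addl n k)).
Qed.

Let tk0 : (t k)%:~R != 0 :> 'F_p.
Proof. by rewrite -(@dvdz_pcharf _ p) // pchar_Fp. Qed.

Let f_back a b : (forall i, (i < k)%N -> f (a.+1 + i) = f (b.+1 + i)) -> f a = f b.
Proof.
move=> E; apply: (mulfI tk0); have := f_rec a; have := f_rec b.
rewrite !big_nat_recr //= !addnK.
have -> : f (b + k) = f (a + k).
  by have := E k.-1; rewrite !addSnnS prednK // => ->.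
move=> -> /eqP; suff -> : \sum_(1 <= j < k) (t j)%:~R * f (b + k - j) =
                  \sum_(1 <= j < k) (t j)%:~R * f (a + k - j).
  by rewrite (inj_eq (addrI _)) => /eqP.
apply: eq_big_nat => j /andP[j0 ltjk]; congr (_ * _).
have := E (k - j.+1)%N; rewrite -subSn // subSS => /(_ (leq_subr _ _)) .
by rewrite !addSnnS subnSK // !addnBA // ltnW.
Qed.

Let f_periodic : exists2 d, (0 < d)%N & forall n, f (n + d) = f n.
Proof.
pose w n : {ffun 'I_k -> 'F_p} := [ffun i : 'I_k => f (n + i)].
have wP a b : w a = w b -> forall i, (i < k)%N -> f (a + i) = f (b + i).
  by move=> /ffunP E i ik; have := E (Ordinal ik); rewrite !ffunE.
have [a [b [ltab wab]]] : exists a b, (a < b)%N /\ w a = w b.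
  apply: contrapT => noab.
  have winj : injective (fun i : 'I_(#|{ffun 'I_k -> 'F_p}|.+1) => w i).
    move=> i j E; apply/val_inj; case: (ltngtP i j) => // lt; case: noab.
      by exists i, j.
    by exists j, i.
  by have := leq_card _ winj; rewrite card_ord ltnn.
exists (b - a)%N; first by rewrite subn_gt0.
have {}wab : forall i, (i < k)%N -> f i = f (b - a + i).
  elim: a b ltab wab => [|a IHa] [|b] // ltab /wP E; first by rewrite subn0.
  rewrite subSS; apply: IHa => //; apply/ffunP => i; rewrite !ffunE.
  case: (val i) (ltn_ord i) => [|j] ltj; first by rewrite !addn0; exact: f_back.
  by rewrite -!addSnnS; apply: E; exact: ltnW.
move=> n; rewrite addnC; elim/ltn_ind: n => n IHn.
have [/wab//|lekn] := ltnP n k.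
have := f_rec (n - k); have := f_rec (b - a + (n - k)).
rewrite -addnA subnK // => -> ->.
apply: eq_big_nat => j /andP[j0 ltjk].
have ltn : (n - j < n)%N by rewrite ltn_subrL j0 (leq_trans k_gt0).
rewrite -(IHn _ ltn).
by rewrite addnBA // (leq_trans _ lekn).
Qed.

Lemma gfib_periodP :
  is_least_period (fun n : nat => (gfib k t n %% p)%Z) (gfib_period p k t).
Proof.
apply: (@xgetPex _ 0%N [set c | is_least_period _ c]) => /=.
have [d d0 fd] := f_periodic.
pose P c := (0 < c)%N && `[< forall n : nat,
  (gfib k t (n + c)%N %% p)%Z = (gfib k t n %% p)%Z >].
have exP : exists c, P c.
  exists d; rewrite /P d0; apply/asboolP => n; apply/eqP.
  by rewrite -intr_Fp_eq; apply/eqP; exact: fd.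
case: (ex_minnP exP) => c /andP[c0 /asboolP cP] cmin.
exists c; split=> // e e0 eP; apply: cmin.
by rewrite /P e0; apply/asboolP.
Qed.

End PeriodExists.

(* Main.v *)
Require Import Defs.
From mathcomp Require Import all_boot all_order all_algebra all_field.
From mathcomp Require Import zify.
Import Order.TTheory GRing.Theory Num.Theory.
Local Open Scope ring_scope.

(* Write [Cp] for the reduction of the core polynomial modulo p.  The numbers
   F_n mod p are the coefficients of X^(k-1) in X^(n+k-1) mod Cp, and this
   coefficient functional vanishes on all shifts of g only if Cp divides g;
   as X is invertible modulo Cp, d is a period iff Cp divides X^d - 1.  If p does
   not divide the least period c, then X^c - 1 is separable, hence so is Cp; if
   c = m p, then X^c - 1 = (X^m - 1)^p, and a separable Cp would divide X^m - 1,
   against minimality.  Finally disc(C) = +- det C'(A) for an integer matrix A with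
   characteristic polynomial C, and this determinant vanishes modulo p iff C' and
   C have a common root over the algebraic closure of F_p. *)

Lemma char_poly_surj (R : comNzRingType) (n : nat) (f : {poly R}) :
  f \is monic -> size f = n.+1 -> exists A : 'M[R]_n, char_poly A = f.
Proof.
move=> f_monic size_f; have := companionmxK f_monic.
by move: (companionmx f); rewrite size_f /= => A <-; exists A.
Qed.

Lemma horner_char_poly (R : comNzRingType) (n : nat) (A : 'M[R]_n) (x : R) :
  (char_poly A).[x] = \det (x%:M - A).
Proof.
rewrite -[LHS]/(horner_eval x _) -det_map_mx; congr (\det _).
apply/matrixP => i j; rewrite !mxE /= /horner_eval.
by rewrite hornerD hornerN hornerMn hornerX hornerC.
Qed.

(** Split [q] into linear factors [X - w]: each contributes [\det (A - w%:M)], which is the product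
    of [z - w] over the roots [z] of the characteristic polynomial. Exchanging the two products
    regroups the factors by [z]. *)
Lemma det_horner_mx (F : closedFieldType) (n : nat) (A : 'M[F]_n.+1)
    (r : seq F) (q : {poly F}) :
  char_poly A = \prod_(z <- r) ('X - z%:P) ->
  \det (horner_mx A q) = \prod_(z <- r) q.[z].
Proof.
move=> charA; have size_r : size r = n.+1.
  by apply: succn_inj; rewrite -(size_prod_XsubC r id) -charA size_char_poly.
(* There are exactly [n.+1] roots, so the scalars that [detZ] raises to the power [n.+1] ([-1] and
   the leading coefficient of [q]) are spread one per root. *)
have prod_const (c : F) : c ^+ n.+1 = \prod_(z <- r) c.
  by rewrite big_const_seq count_predT iter_mulr mulr1 size_r.
have det_sub w : \det (A - w%:M) = \prod_(z <- r) (z - w).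
  rewrite -opprB -scaleN1r detZ -horner_char_poly charA horner_prod.
  rewrite prod_const -big_split /=; apply: eq_bigr => z _.
  by rewrite hornerXsubC mulN1r opprB.
have [s ->] := closed_field_poly_normal q; set c := lead_coef q.
rewrite linearZ /= detZ rmorph_prod /=.
under eq_bigr do rewrite rmorphB /= horner_mx_X horner_mx_C.
rewrite (big_morph _ (@det_mulmx _ n.+1) (det1 _ _)).
under eq_bigr do rewrite det_sub.
rewrite exchange_big prod_const -big_split /=.
apply: eq_bigr => z _; rewrite hornerZ horner_prod.
by under [in RHS]eq_bigr do rewrite hornerXsubC.
Qed.

Lemma det_horner_char_poly_deriv (F : countFieldType) (n : nat) (A : 'M[F]_n.+1) :
  (\det (horner_mx A (char_poly A)^`()) != 0) = separable_poly (char_poly A).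
Proof.
have [K [f _]] := countable_algebraic_closure F.
rewrite -(separable_map f) -(fmorph_eq0 f) -det_map_mx map_horner_mx -deriv_map.
rewrite map_char_poly; set B := map_mx f A.
have [r] := closed_field_poly_normal (char_poly B).
rewrite (monicP (char_poly_monic B)) scale1r => charB.
(* [unlock] exposes separability as coprimality with the derivative, that is, absence of a common
   root in [K]. *)
rewrite (det_horner_mx K n B r) // prodf_seq_neq0 unlock.
apply/allP/Pdiv.ClosedField.coprimepP => [nz z | nz z rz] /=.
  by rewrite charB root_prod_XsubC => /nz; rewrite charB.
by apply: nz; rewrite charB root_prod_XsubC.
Qed.

Lemma dvdC_intr (p : nat) (z : int) : (p %| (z%:~R : algC))%C = (p %| z)%Z.
Proof. by rewrite dvdC_int ?rpred_int // intrKfloor. Qed.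

Lemma dvdC_disc (p : nat) (f : {poly int}) :
    prime p -> f \is monic -> (1 < size f)%N ->
  (p %| disc f)%C = ~~ separable_poly (map_poly intr f : {poly 'F_p}).
Proof.
move=> p_pr f_monic; case size_f: (size f) => [|[|n]] // _.
have [A charA] := char_poly_surj _ _ _ f_monic size_f.
(* The integer [D] links the two sides: its image in [algC] is the product in [disc f], and its
   image in ['F_p] decides separability. *)
pose D := \det (horner_mx A f^`()).
have map_det (R : comNzRingType) :
    D%:~R = \det (horner_mx (map_mx intr A) (map_poly intr f^`())) :> R.
  by rewrite -map_horner_mx det_map_mx.
have -> : disc f = ((-1) ^+ ((n.+1 * n)./2) * D)%:~R.
  rewrite rmorphM rmorphXn rmorphN1 /disc size_f /= map_det; congr (_ * _).
  rewrite (det_horner_mx _ _ _ (complex_roots f)) //.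
  by rewrite -map_char_poly charA complex_rootsE.
rewrite dvdC_intr (dvdz_pcharf (pchar_Fp p_pr)) rmorphM rmorphXn rmorphN1.
rewrite mulf_eq0 signr_eq0 /= map_det -charA -deriv_map map_char_poly.
by rewrite -det_horner_char_poly_deriv negbK.
Qed.

(** By separability the cofactor of [gcdp f g] in [f] is coprime to [g]; as it also divides
    [g ^+ n], it is constant. *)
Lemma separable_dvdp_exp (F : fieldType) (f g : {poly F}) (n : nat) :
  separable_poly f -> f %| g ^+ n -> f %| g.
Proof.
move=> sep_f f_gn; have := dvdp_gcdl f g; rewrite dvdp_eq => /eqP def_f.
have cop_h : coprimep (f %/ gcdp f g) g.
  have cop := separable_coprime sep_f (_ : f %/ gcdp f g * gcdp f g %| f).
  rewrite -def_f dvdpp in cop; have {}cop := cop isT.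
  apply/coprimepP => d d_h d_g; apply: (elimT (coprimepP _ _) cop) => //.
  by rewrite dvdp_gcd d_g (dvdp_trans d_h) // divp_dvd // dvdp_gcdl.
have h1 : f %/ gcdp f g %= 1.
  apply: (elimT (coprimepP _ _) (coprimep_expr n cop_h)) => //.
  by apply: dvdp_trans f_gn; rewrite divp_dvd // dvdp_gcdl.
by rewrite {1}def_f (eqp_dvdl _ (eqp_mulr _ h1)) mul1r dvdp_gcdr.
Qed.

Lemma Frobenius_Xn_sub_1 (R : comNzRingType) (p m : nat) :
  p \in [pchar R] -> 'X^(m * p) - 1 = ('X^m - 1) ^+ p :> {poly R}.
Proof.
move=> pcharR; have pcharP : p \in [pchar {poly R}] by rewrite pchar_poly.
rewrite -(pFrobenius_autE pcharP) pFrobenius_autB_comm; last exact: mulrC.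
by rewrite pFrobenius_aut1 pFrobenius_autE exprM.
Qed.

Lemma dvdp_coef_mod (F : fieldType) (f g : {poly F}) (k : nat) :
    size f = k.+2 ->
  (f %| g) <-> (forall n, ((g * 'X^n) %% f)`_k = 0).
Proof.
move=> size_f; split=> [f_g n | coef0].
  by rewrite (eqP (_ : f %| _)) ?coef0 // dvdp_mulr.
apply/eqP; have f_neq0 : f != 0 by rewrite -size_poly_eq0 size_f.
apply: contraTeq isT => r_neq0; have := ltn_modpN0 g f_neq0; rewrite size_f ltnS.
(* A nonzero remainder [r] is shifted so that its leading coefficient lands in degree [k], the
   highest that needs no further reduction modulo [f]. *)
set r := g %% f in r_neq0 * => le_r; have := coef0 (k.+1 - size r)%N.
rewrite mulrC -modp_mul -/r mulrC modp_small; last first.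
  by rewrite size_mulXn // size_f subnK.
have r_gt0 : (0 < size r)%N by rewrite size_poly_gt0.
rewrite coefMXn.
have -> : (k < k.+1 - size r)%N = false by lia.
have -> : (k - (k.+1 - size r) = (size r).-1)%N by lia.
by move/eqP; rewrite -lead_coefE lead_coef_eq0 (negPf r_neq0).
Qed.

Section CorePolyField.

Variables (F : fieldType) (k : nat) (t : nat -> int).

Let C : {poly F} := map_poly intr (core_poly k.+1 t).

Lemma map_core_poly :
  C = 'X^(k.+1) - \sum_(1 <= j < k.+2) (t j)%:~R *: 'X^(k.+1 - j).
Proof.
rewrite /C /core_poly rmorphB /= map_polyXn rmorph_sum /=; congr (_ - _).
by apply: eq_bigr => j _; rewrite map_polyZ map_polyXn.
Qed.

Lemma size_map_core_poly : size C = k.+2.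
Proof.
rewrite size_map_poly_id0 ?size_core_poly //.
by rewrite (monicP (core_poly_monic _ _)) oner_eq0.
Qed.

(** Reduction modulo [C] turns the powers of X into a sequence with the recurrence of [gfib]; the
    exponents below [k] give the zero initial values at negative indices. *)
Lemma coef_Xn_mod_core_poly (n : nat) :
  ('X^(n + k) %% C)`_k = (gfib k.+1 t n)%:~R.
Proof.
have coef_small m : (m < k)%N -> ('X^m %% C)`_k = 0.
  move=> ltmk; rewrite modp_small ?coefXn ?gtn_eqF //.
  by rewrite size_map_core_poly size_polyXn; lia.
elim/ltn_ind: n => -[_|n IHn].
  by rewrite modp_small ?coefXn ?eqxx // size_map_core_poly size_polyXn.
have -> : 'X^(n.+1 + k) =
    'X^n * C + \sum_(1 <= j < k.+2) (t j)%:~R *: 'X^(n + (k.+1 - j)).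
  rewrite map_core_poly mulrBr mulr_sumr -exprD addSnnS -addrA -[LHS]addr0.
  congr (_ + _); rewrite addrC -sumrB big1 // => j _.
  by rewrite -scalerAr -exprD subrr.
rewrite modpD modp_mull add0r (big_morph _ (modpD C) (mod0p C)).
rewrite coef_sum gfib_rec // rmorph_sum; apply: eq_big_nat => j /andP[j_gt0 le_j].
rewrite modpZl coefZ rmorphM /=; congr (_ * _).
have [lt_nj|le_jn] := ltnP n.+1 j.
  by rewrite coef_small ?gfib_neg ?rmorph0 //; lia.
have -> : (n + (k.+1 - j) = (n.+1 - j) + k)%N by lia.
by rewrite IHn -?subzn //; lia.
Qed.

End CorePolyField.

Lemma gfib_period_dvdp (p k : nat) (t : nat -> int) (d : nat) :
    prime p -> ~~ (p %| t k.+1)%Z ->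
  (forall n : nat, gfib k.+1 t (n + d)%N = gfib k.+1 t n %[mod p])%Z <->
  (map_poly intr (core_poly k.+1 t) : {poly 'F_p}) %| 'X^d - 1.
Proof.
move=> p_pr p_tk; pose C : {poly 'F_p} := map_poly intr (core_poly k.+1 t).
(* The constant term of [C] is [- t k.+1], nonzero modulo [p]. Hence the factor ['X^k], which
   offsets the exponent [n + k] belonging to [gfib] at [n], can be cancelled. *)
have cop_X : coprimep C 'X^k.
  rewrite coprimep_expr // coprimepX rootE /C map_core_poly big_nat_recr //=.
  rewrite subnn hornerD hornerN hornerD horner_sum.
  rewrite big_nat big1 => [|j /andP[_ lt_j]].
    rewrite hornerZ !hornerXn !expr0n !sub0r add0r mulr1 oppr_eq0.
    by rewrite -(dvdz_pcharf (pchar_Fp p_pr)).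
  by rewrite hornerZ hornerXn expr0n subn_eq0 leqNgt lt_j mulr0.
have coefE n : ((('X^d - 1) * 'X^k * 'X^n) %% C)`_k =
    (gfib k.+1 t (n + d)%N - gfib k.+1 t n)%:~R.
  rewrite -mulrA -exprD mulrBl mul1r -exprD modpD modpN coefB.
  by rewrite addnC -addnA addnC (addnC k) !coef_Xn_mod_core_poly rmorphB.
rewrite -(Gauss_dvdpl _ cop_X).
rewrite -/C (dvdp_coef_mod _ _ _ k) ?size_map_core_poly //.
have congE n : (gfib k.+1 t (n + d)%N = gfib k.+1 t n %[mod p])%Z <->
    ((('X^d - 1) * 'X^k * 'X^n) %% C)`_k = 0.
  rewrite coefE; apply: (iff_trans (rwP eqP)).
  rewrite eqz_mod_dvd (dvdz_pcharf (pchar_Fp p_pr)).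
  exact: iff_sym (rwP eqP).
by split=> per n; apply/congE.
Qed.

Theorem theorem6p7 (k : nat) (t : nat -> int) (p : nat)
    (hk : (1 <= k)%N)
    (hirr : irreducible_poly (map_poly intr (core_poly k t) : {poly rat}))
    (hp : prime p)
    (hpt : ~~ (p %| t k)%Z) :
  (p %| gfib_period p k t)%N <-> (p %| disc (core_poly k t))%C.
Proof.
rewrite dvdC_disc ?core_poly_monic ?size_core_poly //.
have [c_gt0 + c_min] := gfib_periodP hk hp hpt.
move: (gfib_period p k t) c_gt0 c_min => c c_gt0 c_min.
case: k hk hirr hpt c_min => // k _ _ hpt c_min.
rewrite gfib_period_dvdp //; set C := map_poly _ _ => C_c.
have charp := pchar_Fp hp; split=> [p_c | ].
  apply/negP => sepC; have [m def_c] := dvdnP p_c.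
  rewrite def_c Frobenius_Xn_sub_1 // in C_c.
  have C_m := separable_dvdp_exp _ _ _ _ sepC C_c.
  have m_per := (gfib_period_dvdp _ _ _ _ hp hpt).2 C_m.
  have m_gt0 : (0 < m)%N by move: c_gt0; rewrite def_c muln_gt0 => /andP[].
  by have := c_min m m_gt0 m_per; rewrite def_c leqNgt ltn_Pmulr ?prime_gt1.
apply: contraR => p_c; apply: dvdp_separable C_c _.
by apply: separable_Xn_sub_1; rewrite -(dvdn_pcharf charp).
Qed.
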